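(* In the setting described in the context, for any $(\bar x,\bar y)\in C$, the problem $$(\mathrm{VP})_\epsilon\qquad\min_{(x,y)\in C}F_1(x,y)-F_2(x,y)\quad\text{s.t.}\quad f(x,y)-v(x)\le\epsilon$$ with $\epsilon>0$ satisfies ENNAMCQ at $(\bar x,\bar y)$.
   Context: Setting. $X\subseteq\mathbb{R}^n$ and $Y\subseteq\mathbb{R}^m$ are nonempty closed convex sets; $g=(g_1,\dots,g_l)$, where each $g_i:\mathbb{R}^n\times\mathbb{R}^m\to\mathbb{R}$ is convex (jointly in $(x,y)$) on an open convex set containing $X\times Y$; $C:=\{(x,y)\in X\times Y: g(x,y)\le0\}$; and $F_1,F_2,f:\mathbb{R}^n\times\mathbb{R}^m\to\mathbb{R}$ are convex (jointly in $(x,y)$) on an open convex set containing $C$. For every $x\in X$ the lower level problem $\min_{y\in Y}f(x,y)$ s.t. $g(x,y)\le0$ has a solution. $\mathcal O\supseteq X$ is an open convex set such that for all $x\in\mathcal O$ the set $\mathcal F(x)=\{y\in Y:g(x,y)\le0\}$ is nonempty and $f(x,\cdot)$ is bounded below on it. The value function is $v(x):=\inf_{y\in Y}\{f(x,y)\ \text{s.t.}\ g(x,y)\le0\}$ for $x\in\mathcal O$, and $v(x):=+\infty$ for $x\notin\mathcal O$. $\partial$ is the subdifferential and $\mathcal N_C$ the normal cone of convex analysis. ENNAMCQ: a point $(\bar x,\bar y)\in C$ satisfies ENNAMCQ for $(\mathrm{VP})_\epsilon$ if either $f(\bar x,\bar y)-v(\bar x)<\epsilon$, or $f(\bar x,\bar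 y)-v(\bar x)\ge\epsilon$ and $$0\notin\partial f(\bar x,\bar y)-\partial v(\bar x)\times\{0\}+\mathcal N_C(\bar x,\bar y).$$ *)

(* Defs.v *)
From HB Require Import structures.
From mathcomp Require Import all_boot all_order all_algebra.
From mathcomp Require Import all_classical all_reals all_analysis.
Import Order.TTheory GRing.Theory Num.Theory.
Import numFieldNormedType.Exports.

Set Implicit Arguments.
Unset Strict Implicit.
Unset Printing Implicit Defensive.

Local Open Scope classical_set_scope.
Local Open Scope ring_scope.

(* R^n is 'rV[R]_n and R^n x R^m is 'rV[R]_n * 'rV[R]_m, with their library
   topologies (the usual ones) and the Euclidean inner products below. *)

Definition dotv (R : realType) (n : nat) (u v : 'rV[R]_n) : R :=
  \sum_(i < n) u 0 i * v 0 i.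

Definition dotp (R : realType) (n m : nat) (z w : 'rV[R]_n * 'rV[R]_m) : R :=
  dotv z.1 w.1 + dotv z.2 w.2.

(* [U] is an open convex set containing [A] on which [phi] is convex. *)
Definition convex_around (R : realType) (n m : nat)
    (A U : set ('rV[R]_n * 'rV[R]_m)) (phi : 'rV[R]_n * 'rV[R]_m -> R) : Prop :=
  [/\ open U, convex_set U, A `<=` U & convex_function U phi].

Definition extend_oo (R : realType) (E : Type) (U : set E) (phi : E -> R) :
    E -> \bar R :=
  fun z => if z \in U then (phi z)%:E else +oo%E.

(* [ip] is the inner product of E; the subdifferential is empty at the points
   where [phi] is not finite. *)
Definition subdifferential (R : realType) (E : zmodType) (ip : E -> E -> R)
    (phi : E -> \bar R) (z : E) : set E :=
  [set xi | phi z \is a fin_num /\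
     forall w, (phi z + (ip xi (w - z))%:E <= phi w)%E].

Definition normal_cone (R : realType) (E : zmodType) (ip : E -> E -> R)
    (C : set E) (z : E) : set E :=
  [set zeta | C z /\ forall w, C w -> ip zeta (w - z) <= 0].

Definition lower_feasible (R : realType) (n m l : nat) (Y : set 'rV[R]_m)
    (g : 'I_l -> 'rV[R]_n * 'rV[R]_m -> R) (x : 'rV[R]_n) : set 'rV[R]_m :=
  [set y | Y y /\ forall i, g i (x, y) <= 0].

Definition joint_feasible (R : realType) (n m l : nat) (X : set 'rV[R]_n)
    (Y : set 'rV[R]_m) (g : 'I_l -> 'rV[R]_n * 'rV[R]_m -> R) :
    set ('rV[R]_n * 'rV[R]_m) :=
  [set z | X z.1 /\ Y z.2 /\ forall i, g i z <= 0].

Definition value_function (R : realType) (n m l : nat) (O : set 'rV[R]_n)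
    (Y : set 'rV[R]_m) (g : 'I_l -> 'rV[R]_n * 'rV[R]_m -> R)
    (f : 'rV[R]_n * 'rV[R]_m -> R) : 'rV[R]_n -> \bar R :=
  fun x => if x \in O
           then ereal_inf [set (f (x, y))%:E | y in lower_feasible Y g x]
           else +oo%E.

(* The qualification condition at [z] for the problem of minimizing over [C]
   subject to f(x,y) - v(x) <= eps; it does not involve the objective.
   [U] is an open convex set on which [f] is convex: the subdifferential of [f]
   is that of [f] extended by +oo outside [U], and is independent of the choice
   of such a [U] containing [z]. *)
Definition ENNAMCQ (R : realType) (n m : nat) (C : set ('rV[R]_n * 'rV[R]_m))
    (U : set ('rV[R]_n * 'rV[R]_m)) (f : 'rV[R]_n * 'rV[R]_m -> R)
    (v : 'rV[R]_n -> \bar R) (eps : R) (z : 'rV[R]_n * 'rV[R]_m) : Prop :=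
  C z /\
  (((f z)%:E - v z.1 < eps%:E)%E \/
   (((f z)%:E - v z.1 >= eps%:E)%E /\
    ~ [set a + c | a in
         [set xi - eta | xi in subdifferential (@dotp R n m) (extend_oo U f) z
                       & eta in subdifferential (@dotv R n) v z.1 `*` [set 0]]
       & c in normal_cone (@dotp R n m) C z] 0)).

(* Main.v *)
Require Import Defs.
From HB Require Import structures.
From mathcomp Require Import all_boot all_order all_algebra.
From mathcomp Require Import all_classical all_reals all_analysis.
From mathcomp Require Import lra.
Import Order.TTheory GRing.Theory Num.Theory.
Import numFieldNormedType.Exports.

Local Open Scope classical_set_scope.
Local Open Scope ring_scope.

(** The condition can fail only where f(x,y) - v(x) >= eps > 0, i.e. where y is
    not optimal for the lower level problem at x.  The proof compares y with a
    lower level solution y0 at the same x.  A relation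
    0 = xi - (eta, 0) + c, with xi a subgradient of f and c in the normal
    cone of C, says that xi + c has no y-component, hence is orthogonal to the
    vertical direction (x,y0) - (x,y), whatever eta is.  Normality of c along
    this direction (lemma [subgradient_le_of_orthogonal]) makes (x,y) at least
    as good as (x,y0), that is f(x,y) <= v(x), since the infimum defining v(x)
    is attained at y0 (lemma [value_function_attained]).  This contradicts
    f(x,y) - v(x) >= eps > 0. *)

Lemma dotpDl (R : realType) (n m : nat) (a b d : 'rV[R]_n * 'rV[R]_m) :
  dotp (a + b) d = dotp a d + dotp b d.
Proof.
rewrite /dotp /dotv addrACA -!big_split /=.
by congr (_ + _); apply: eq_bigr => i _; rewrite mxE mulrDl.
Qed.

Lemma dotp_horizontal_vertical (R : realType) (n m : nat)
    (u : 'rV[R]_n) (d : 'rV[R]_m) : dotp (u, 0) (0, d) = 0.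
Proof.
by rewrite /dotp /dotv !big1 ?addr0 // => i _; rewrite mxE ?mulr0 ?mul0r.
Qed.

(** First-order sufficiency of the multiplier relation, tested in a single
    direction: if xi + c annihilates w - z then <xi, w - z> = - <c, w - z>,
    which is nonnegative as c is normal to C at z. *)
Lemma subgradient_le_of_orthogonal {R : realType} {n m : nat}
    {C U : set ('rV[R]_n * 'rV[R]_m)} {f : 'rV[R]_n * 'rV[R]_m -> R}
    {z w xi c : 'rV[R]_n * 'rV[R]_m} :
  C `<=` U -> C w ->
  subdifferential (@dotp R n m) (extend_oo U f) z xi ->
  normal_cone (@dotp R n m) C z c ->
  dotp (xi + c) (w - z) = 0 -> f z <= f w.
Proof.
move=> CU Cw [_ /(_ w) xi_le] [Cz /(_ w Cw) c_le]; rewrite dotpDl => orth.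
move: xi_le; rewrite /extend_oo !ifT ?inE; [|exact: CU..].
by rewrite -EFinD lee_fin; lra.
Qed.

Lemma value_function_attained {R : realType} {n m l : nat} {O : set 'rV[R]_n}
    {Y : set 'rV[R]_m} {g : 'I_l -> 'rV[R]_n * 'rV[R]_m -> R}
    {f : 'rV[R]_n * 'rV[R]_m -> R} {x : 'rV[R]_n} {y : 'rV[R]_m} :
  O x -> lower_feasible Y g x y ->
  (forall y', lower_feasible Y g x y' -> f (x, y) <= f (x, y')) ->
  value_function O Y g f x = (f (x, y))%:E.
Proof.
move=> Ox yF ymin; rewrite /value_function ifT ?inE //.
apply/le_anti/andP; split; first by apply: ereal_inf_lbound; exists y.
by apply: le_ereal_inf_tmp => _ [y' y'F <-]; rewrite lee_fin ymin.
Qed.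

Theorem proposition8 (R : realType) (n m l : nat)
    (X O : set 'rV[R]_n) (Y : set 'rV[R]_m)
    (g : 'I_l -> 'rV[R]_n * 'rV[R]_m -> R)
    (F1 F2 f : 'rV[R]_n * 'rV[R]_m -> R)
    (U : set ('rV[R]_n * 'rV[R]_m))
    (X_nonempty : X !=set0) (X_closed : closed X) (X_convex : convex_set X)
    (Y_nonempty : Y !=set0) (Y_closed : closed Y) (Y_convex : convex_set Y)
    (g_convex : forall i, exists V, convex_around (X `*` Y) V (g i))
    (F1_convex : exists V, convex_around (joint_feasible X Y g) V F1)
    (F2_convex : exists V, convex_around (joint_feasible X Y g) V F2)
    (f_convex : convex_around (joint_feasible X Y g) U f)
    (lower_solvable : forall x, X x ->
       exists2 y, lower_feasible Y g x y &
         forall y', lower_feasible Y g x y' -> f (x, y) <= f (x, y'))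
    (O_open : open O) (O_convex : convex_set O) (XO : X `<=` O)
    (O_feasible : forall x, O x -> lower_feasible Y g x !=set0)
    (O_bounded : forall x, O x ->
       has_lbound [set f (x, y) | y in lower_feasible Y g x])
    (eps : R) (eps_gt0 : 0 < eps)
    (xbar : 'rV[R]_n) (ybar : 'rV[R]_m)
    (Cbar : joint_feasible X Y g (xbar, ybar)) :
  ENNAMCQ (joint_feasible X Y g) U f (value_function O Y g f) eps
    (xbar, ybar).
Proof.
have [Xx [Yy gle]] := Cbar.
have [y yF ymin] := lower_solvable _ Xx.
split=> //=; rewrite (value_function_attained (XO _ Xx) yF ymin).
have [lt_eps|ge_eps] := ltP ((f (xbar, ybar))%:E - (f (xbar, y))%:E)%E eps%:E.
  by left.
right; split=> // -[_ [xi xi_sub [[eta1 eta2] [_ /= eta2_0] <-]] [c c_normal]].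
move/eqP; rewrite {}eta2_0 addrAC subr_eq0 => /eqP xi_c.
have [_ _ CU _] := f_convex.
have Cy : joint_feasible X Y g (xbar, y) by case: yF.
have : f (xbar, ybar) <= f (xbar, y).
  apply: (subgradient_le_of_orthogonal CU Cy xi_sub c_normal).
  rewrite xi_c (_ : _ - _ = (0, y - ybar)); first exact: dotp_horizontal_vertical.
  by congr pair; rewrite subrr.
by move: ge_eps; rewrite -EFinB lee_fin; lra.
Qed.
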